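(* For each pair $(\mathsf G,\mathsf H)$ of groupoids, $\mathsf{Mor}(\mathsf G,\mathsf H)=(\mathrm{Mor}^1(\mathsf G,\mathsf H)\rightrightarrows \mathrm{Mor}^0(\mathsf G,\mathsf H))$, with the vertical composition $\bullet$ of arrows, is a groupoid.
   Context: A groupoid $\mathsf G=(G^1\rightrightarrows G^0)$ is a small category all of whose arrows are invertible; $G^0$ is the set of objects, $G^1$ the set of arrows, $s,t:G^1\to G^0$ are source and target, $G^1(a,b)$ is the set of arrows from $a$ to $b$. Composition is written from left to right: for $x\in G^1(a,b)$, $y\in G^1(b,c)$ one has $x\cdot y\in G^1(a,c)$. A strict morphism $\mathsf f=(f^0,f^1):\mathsf G\to\mathsf H$ is a functor. A natural transformation $\alpha:\mathsf f\Rightarrow\mathsf g$ is a map $\alpha:G^0\to H^1$ with $\alpha(a)\in H^1(f^0(a),g^0(a))$ and $f^1(x)\cdot\alpha(b)=\alpha(a)\cdot g^1(x)$ for $x\in G^1(a,b)$. A strict morphism $\mathsf f:\mathsf G\to\mathsf H$ is an equivalence if (1) every object of $H^0$ is the target of an arrow whose source lies in $f^0(G^0)$, and (2) $f^1:G^1(a,b)\to H^1(f^0(a),f^0(b))$ is bijective for all $a,b\in G^0$. Fiber product: for strict morphisms $\mathsf f:\mathsf F\to\mathsf H$, $\mathsf g:\mathsf G\to\mathsf H$, the groupoid $\mathsf F\times_{\mathsf H}\mathsf G$ has objects the triples $(a,x,b)$ with $a\in F^0$, $b\in G^0$, $x\in H^1(f^0(a),g^0(b))$; an arrow $(a,x,b)\to(a',x',b')$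 is a pair $(y,z)$ with $y\in F^1(a,a')$, $z\in G^1(b,b')$ and $x\cdot g^1(z)=f^1(y)\cdot x'$; composition is componentwise. $\pi_1,\pi_2$ denote the projections to $\mathsf F$ and $\mathsf G$. Morphisms: $\mathrm{Mor}^0(\mathsf G,\mathsf H)$ is the set of morphisms $(\psi,\mathsf K,\mathsf u):\mathsf G\rightharpoonup\mathsf H$, i.e. pairs of strict morphisms $\mathsf G\xleftarrow{\psi}\mathsf K\xrightarrow{\mathsf u}\mathsf H$ with $\psi$ an equivalence. An arrow $(\psi_1,\mathsf K_1,\mathsf u_1)\xrightarrow{\alpha}(\psi_2,\mathsf K_2,\mathsf u_2)$ is a natural transformation $\alpha:\mathsf u_1\circ\pi_1\Rightarrow\mathsf u_2\circ\pi_2:\mathsf K_1\times_{\mathsf G}\mathsf K_2\to\mathsf H$ (fiber product over $\psi_1,\psi_2$). $\mathrm{Mor}^1(\mathsf G,\mathsf H)$ is the disjoint union of the sets of arrows over all pairs of morphisms. Vertical composition: for arrows $\alpha_i:(\psi_i,\mathsf K_i,\mathsf u_i)\to(\psi_{i+1},\mathsf K_{i+1},\mathsf u_{i+1})$, $i=1,2$, the arrow $\alpha_1\bullet\alpha_2:(\psi_1,\mathsf K_1,\mathsf u_1)\to(\psi_3,\mathsf K_3,\mathsf u_3)$ is $(\alpha_1\bullet\alpha_2)(k_1,x,k_3)=\alpha_1(k_1,x_1,k_2)\cdot\alpha_2(k_2,x_2,k_3)$ for any $k_2\in K_2^0$ and any splitting $x=x_1\cdot x_2$ in $G^1$ with $\psi_1^0(k_1)\xrightarrow{x_1}\psi_2^0(k_2)\xrightarrow{x_2}\psi_3^0(k_3)$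 (this is independent of the choice of splitting). *)

(* Defs.v *)
From Stdlib Require Import FinFun FunctionalExtensionality ProofIrrelevance.
From Stdlib Require Import IndefiniteDescription.

Set Implicit Arguments.
Unset Strict Implicit.

(* Arrows are given as the family of the sets G^1(a,b); G^1 itself is the disjoint
   union of this family.  [comp] composes from left to right. *)
Record is_groupoid (ob : Type) (hom : ob -> ob -> Type)
    (id : forall a, hom a a)
    (comp : forall a b c, hom a b -> hom b c -> hom a c) : Prop := IsGroupoid {
  is_assoc : forall a b c d (x : hom a b) (y : hom b c) (z : hom c d),
    comp _ _ _ x (comp _ _ _ y z) = comp _ _ _ (comp _ _ _ x y) z;
  is_idl : forall a b (x : hom a b), comp _ _ _ (id a) x = x;
  is_idr : forall a b (x : hom a b), comp _ _ _ x (id b) = x;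
  is_inv : forall a b (x : hom a b), exists y : hom b a,
    comp _ _ _ x y = id a /\ comp _ _ _ y x = id b
}.

Record groupoid : Type := Groupoid {
  ob :> Type;
  hom : ob -> ob -> Type;
  id : forall a, hom a a;
  comp : forall a b c, hom a b -> hom b c -> hom a c;
  groupoidP : is_groupoid id comp
}.

Arguments hom {g} a b.
Arguments id {g} a.
Arguments comp {g a b c} x y.

Declare Scope groupoid_scope.
Local Open Scope groupoid_scope.
Notation "x · y" := (comp x y) (at level 40, left associativity) : groupoid_scope.

Record functor (G H : groupoid) : Type := Functor {
  fob :> G -> H;
  fhom : forall a b, hom a b -> hom (fob a) (fob b);
  fhom_id : forall a, fhom (id a) = id (fob a);
  fhom_comp : forall a b c (x : hom a b) (y : hom b c),
    fhom (x · y) = fhom x · fhom y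
}.

Arguments fhom {G H} f {a b} x : rename.

Definition fcomp (F G H : groupoid) (f : functor F G) (g : functor G H) :
  functor F H.
Proof.
refine (@Functor F H (fun a => g (f a)) (fun a b x => fhom g (fhom f x)) _ _).
- intros a. now rewrite !fhom_id.
- intros a b c x y. now rewrite !fhom_comp.
Defined.

Notation "g ∘ f" := (fcomp f g) (at level 40, left associativity) : groupoid_scope.

Record nattrans (G H : groupoid) (f g : functor G H) : Type := NatTrans {
  ncomp :> forall a : G, hom (f a) (g a);
  natural : forall (a b : G) (x : hom a b), fhom f x · ncomp b = ncomp a · fhom g x
}.

Record is_equivalence (G H : groupoid) (f : functor G H) : Prop := IsEquivalence {
  ess_surj : forall c : H, exists a : G, inhabited (hom (f a) c);
  full_faithful : forall a b : G, Bijective (fun x : hom a b => fhom f x)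
}.

Section FiberProduct.
Variables (F G H : groupoid) (f : functor F H) (g : functor G H).

Record fp_ob : Type := Fp {
  fp1 : F;
  fp2 : G;
  fpx : hom (f fp1) (g fp2)
}.

Record fp_hom (p q : fp_ob) : Type := FpHom {
  fph1 : hom (fp1 p) (fp1 q);
  fph2 : hom (fp2 p) (fp2 q);
  fph_comm : fpx p · fhom g fph2 = fhom f fph1 · fpx q
}.

Lemma fp_hom_eq (p q : fp_ob) (y z : fp_hom p q) :
  fph1 y = fph1 z -> fph2 y = fph2 z -> y = z.
Proof.
destruct y as [y1 y2 hy], z as [z1 z2 hz]; simpl; intros <- <-.
f_equal; apply proof_irrelevance.
Qed.

Definition fp_id (p : fp_ob) : fp_hom p p.
Proof.
refine (@FpHom p p (id _) (id _) _).
rewrite !fhom_id, (is_idl (groupoidP H)); apply (is_idr (groupoidP H)).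
Defined.

Definition fp_comp (p q r : fp_ob) (y : fp_hom p q) (z : fp_hom q r) : fp_hom p r.
Proof.
refine (@FpHom p r (fph1 y · fph1 z) (fph2 y · fph2 z) _).
now rewrite !fhom_comp, (is_assoc (groupoidP H)), fph_comm,
  <- (is_assoc (groupoidP H)), fph_comm, (is_assoc (groupoidP H)).
Defined.

Lemma fp_groupoidP : is_groupoid fp_id fp_comp.
Proof.
split.
- intros; apply fp_hom_eq; apply (is_assoc (groupoidP _)).
- intros; apply fp_hom_eq; apply (is_idl (groupoidP _)).
- intros; apply fp_hom_eq; apply (is_idr (groupoidP _)).
- intros p q [y z h].
  destruct (is_inv (groupoidP F) y) as [y' [hy hy']].
  destruct (is_inv (groupoidP G) z) as [z' [hz hz']].
  assert (h' : fpx q · fhom g z' = fhom f y' · fpx p).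
  { rewrite <- (is_idl (groupoidP H) (fpx q)), <- fhom_id, <- hy', fhom_comp.
    rewrite <- (is_assoc (groupoidP H) (fhom f y')), <- h.
    rewrite <- !(is_assoc (groupoidP H)), <- fhom_comp, hz, fhom_id.
    now rewrite (is_idr (groupoidP H)). }
  exists (FpHom h'); split; apply fp_hom_eq; assumption.
Qed.

Definition fiber_product : groupoid := Groupoid fp_groupoidP.

Definition fproj1 : functor fiber_product F :=
  @Functor fiber_product F fp1 (fun p q y => fph1 y)
    (fun _ => eq_refl) (fun _ _ _ _ _ => eq_refl).

Definition fproj2 : functor fiber_product G :=
  @Functor fiber_product G fp2 (fun p q y => fph2 y)
    (fun _ => eq_refl) (fun _ _ _ _ _ => eq_refl).

End FiberProduct.

Arguments Fp {F G H f g} fp1 fp2 fpx.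
Arguments fproj1 {F G H} f g.
Arguments fproj2 {F G H} f g.

(* Since [mid] ranges over all small groupoids, [mor G H] is one universe above
   [groupoid]'s components: it is not itself an [ob], but [is_groupoid] applies to it. *)
Record mor (G H : groupoid) : Type := Mor {
  mid : groupoid;
  mpsi : functor mid G;
  mu : functor mid H;
  mpsi_equiv : is_equivalence mpsi
}.

Definition arrow (G H : groupoid) (m1 m2 : mor G H) : Type :=
  nattrans (mu m1 ∘ fproj1 (mpsi m1) (mpsi m2)) (mu m2 ∘ fproj2 (mpsi m1) (mpsi m2)).

Definition is_vcomp (G H : groupoid) (m1 m2 m3 : mor G H)
    (al1 : arrow m1 m2) (al2 : arrow m2 m3) (al : arrow m1 m3) : Prop :=
  forall (k1 : mid m1) (k2 : mid m2) (k3 : mid m3)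
    (x : hom (mpsi m1 k1) (mpsi m3 k3))
    (x1 : hom (mpsi m1 k1) (mpsi m2 k2)) (x2 : hom (mpsi m2 k2) (mpsi m3 k3)),
    x = x1 · x2 -> al (Fp k1 k3 x) = al1 (Fp k1 k2 x1) · al2 (Fp k2 k3 x2).

Lemma nattrans_eq (G H : groupoid) (f g : functor G H) (al be : nattrans f g) :
  (forall a, al a = be a) -> al = be.
Proof.
destruct al as [al hal], be as [be hbe]; simpl; intros e.
assert (e' : al = be) by now apply functional_extensionality_dep.
destruct e'; f_equal; apply proof_irrelevance.
Qed.

Lemma splitting_exists (G H : groupoid) (m1 m2 m3 : mor G H)
    (k1 : mid m1) (k3 : mid m3) (x : hom (mpsi m1 k1) (mpsi m3 k3)) :
  exists (k2 : mid m2) (x1 : hom (mpsi m1 k1) (mpsi m2 k2))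
    (x2 : hom (mpsi m2 k2) (mpsi m3 k3)), x = x1 · x2.
Proof.
destruct (ess_surj (mpsi_equiv m2) (mpsi m1 k1)) as [k2 [y]].
destruct (is_inv (groupoidP G) y) as [y' [_ hy]].
exists k2, y', (y · x).
now rewrite (is_assoc (groupoidP G)), hy, (is_idl (groupoidP G)).
Qed.

Lemma splitting_indep (G H : groupoid) (m1 m2 m3 : mor G H)
    (al1 : arrow m1 m2) (al2 : arrow m2 m3) (k1 : mid m1) (k3 : mid m3)
    (k2 k2' : mid m2)
    (x1 : hom (mpsi m1 k1) (mpsi m2 k2)) (x2 : hom (mpsi m2 k2) (mpsi m3 k3))
    (x1' : hom (mpsi m1 k1) (mpsi m2 k2')) (x2' : hom (mpsi m2 k2') (mpsi m3 k3)) :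
  x1 · x2 = x1' · x2' ->
  al1 (Fp k1 k2 x1) · al2 (Fp k2 k3 x2) = al1 (Fp k1 k2' x1') · al2 (Fp k2' k3 x2').
Proof.
intros e.
destruct (is_inv (groupoidP G) x1) as [y [hxy hyx]].
destruct (full_faithful (mpsi_equiv m2) k2 k2') as [g [_ hg]].
pose proof (hg (y · x1')) as hz; set (z := g (y · x1')) in hz.
assert (h1 : x1 · fhom (mpsi m2) z = fhom (mpsi m1) (id k1) · x1').
{ now rewrite hz, fhom_id, (is_assoc (groupoidP G)), hxy. }
assert (h2 : x2 · fhom (mpsi m3) (id k3) = fhom (mpsi m2) z · x2').
{ rewrite hz, fhom_id, <- (is_assoc (groupoidP G)), <- e, (is_assoc (groupoidP G)), hyx.
  now rewrite (is_idl (groupoidP G)), (is_idr (groupoidP G)). }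
pose proof (natural al1 (FpHom (p := Fp k1 k2 x1) (q := Fp k1 k2' x1') h1)) as n1.
pose proof (natural al2 (FpHom (p := Fp k2 k3 x2) (q := Fp k2' k3 x2') h2)) as n2.
simpl in n1, n2.
rewrite fhom_id, (is_idl (groupoidP H)) in n1.
rewrite fhom_id, (is_idr (groupoidP H)) in n2.
etransitivity; [ apply f_equal; symmetry; exact n2 | ].
etransitivity; [ apply (is_assoc (groupoidP H)) | ].
now apply (f_equal (fun w => w · al2 (Fp k2' k3 x2'))).
Qed.

Lemma vcomp_exists (G H : groupoid) (m1 m2 m3 : mor G H)
    (al1 : arrow m1 m2) (al2 : arrow m2 m3) :
  exists al : arrow m1 m3, is_vcomp al1 al2 al.
Proof.
assert (ex : forall p : fiber_product (mpsi m1) (mpsi m3),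
  exists w : hom (mu m1 (fp1 p)) (mu m3 (fp2 p)),
  forall k2 x1 x2, fpx p = x1 · x2 ->
    w = al1 (Fp (fp1 p) k2 x1) · al2 (Fp k2 (fp2 p) x2)).
{ intros [k1 k3 x]; simpl.
  destruct (splitting_exists m2 x) as [k2 [x1 [x2 e]]].
  exists (al1 (Fp k1 k2 x1) · al2 (Fp k2 k3 x2)).
  intros k2' x1' x2' e'; apply splitting_indep; congruence. }
pose (w p := proj1_sig (constructive_indefinite_description _ (ex p))).
pose proof (fun p => proj2_sig (constructive_indefinite_description _ (ex p))) as hw.
change (forall p k2 x1 x2, fpx p = x1 · x2 ->
    w p = al1 (Fp (fp1 p) k2 x1) · al2 (Fp k2 (fp2 p) x2)) in hw.
clearbody w.
assert (nat : forall (p q : fiber_product (mpsi m1) (mpsi m3)) (yz : hom p q),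
  fhom (mu m1) (fph1 yz) · w q = w p · fhom (mu m3) (fph2 yz)).
{ intros [k1 k3 x] [k1' k3' x'] [y z h]; simpl in *.
  destruct (splitting_exists m2 x') as [k2 [x1 [x2 e]]].
  destruct (is_inv (groupoidP G) (fhom (mpsi m3) z)) as [z' [hz hz']].
  assert (h1 : (fhom (mpsi m1) y · x1) · fhom (mpsi m2) (id k2)
    = fhom (mpsi m1) y · x1)
    by now rewrite fhom_id, (is_idr (groupoidP G)).
  assert (h2 : (x2 · z') · fhom (mpsi m3) z = fhom (mpsi m2) (id k2) · x2)
    by now rewrite fhom_id, <- (is_assoc (groupoidP G)), hz',
      (is_idl (groupoidP G)), (is_idr (groupoidP G)).
  pose proof (natural al1
    (FpHom (p := Fp k1 k2 (fhom (mpsi m1) y · x1)) (q := Fp k1' k2 x1) h1)) as n1.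
  pose proof (natural al2
    (FpHom (p := Fp k2 k3 (x2 · z')) (q := Fp k2 k3' x2) h2)) as n2.
  simpl in n1, n2.
  rewrite fhom_id, (is_idr (groupoidP H)) in n1.
  rewrite fhom_id, (is_idl (groupoidP H)) in n2.
  rewrite (hw (Fp k1' k3' x') k2 x1 x2 e).
  rewrite (hw (Fp k1 k3 x) k2 (fhom (mpsi m1) y · x1) (x2 · z')).
  - simpl. etransitivity; [ apply (is_assoc (groupoidP H)) | ].
    etransitivity; [ apply (f_equal (fun v => v · _)); exact n1 | ].
    etransitivity; [ apply f_equal; exact n2 | ].
    apply (is_assoc (groupoidP H)).
  - simpl. rewrite (is_assoc (groupoidP G)), <- (is_assoc (groupoidP G) _ x1), <- e, <- h.
    now rewrite <- (is_assoc (groupoidP G)), hz, (is_idr (groupoidP G)). }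
exists (NatTrans (f := mu m1 ∘ fproj1 (mpsi m1) (mpsi m3))
  (g := mu m3 ∘ fproj2 (mpsi m1) (mpsi m3)) (ncomp := w) nat).
intros k1 k2 k3 x x1 x2 e; exact (hw (Fp k1 k3 x) k2 x1 x2 e).
Qed.

Lemma vcomp_unique (G H : groupoid) (m1 m2 m3 : mor G H)
    (al1 : arrow m1 m2) (al2 : arrow m2 m3) (al be : arrow m1 m3) :
  is_vcomp al1 al2 al -> is_vcomp al1 al2 be -> al = be.
Proof.
intros hal hbe; apply nattrans_eq; intros [k1 k3 x].
destruct (splitting_exists m2 x) as [k2 [x1 [x2 e]]].
etransitivity; [ exact (hal _ _ _ _ _ _ e) | symmetry; exact (hbe _ _ _ _ _ _ e) ].
Qed.

(* By [vcomp_unique], the arrow chosen here is the only one satisfying [is_vcomp]. *)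
Definition vcomp (G H : groupoid) (m1 m2 m3 : mor G H)
    (al1 : arrow m1 m2) (al2 : arrow m2 m3) : arrow m1 m3 :=
  proj1_sig (constructive_indefinite_description _ (vcomp_exists al1 al2)).

Lemma vcompP (G H : groupoid) (m1 m2 m3 : mor G H)
    (al1 : arrow m1 m2) (al2 : arrow m2 m3) : is_vcomp al1 al2 (vcomp al1 al2).
Proof.
exact (proj2_sig (constructive_indefinite_description _ (vcomp_exists al1 al2))).
Qed.

(* Main.v *)
Require Import Defs.
From Stdlib Require Import IndefiniteDescription.

(** An arrow from [(ψ1, K1, u1)] to [(ψ2, K2, u2)] is a family of arrows
    [α(k1, x, k2) : u1 k1 -> u2 k2] of [H], natural in [k1] and [k2].  Since
    each [ψi] is fully faithful, an arrow [x : ψ k -> ψ k'] of [G] is the same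
    thing as an arrow [z : k -> k'] of the middle groupoid.

    Hence the identity of [(ψ, K, u)] has the component [u z] at
    [(k, ψ z, k')], and the inverse of [α] has the component
    [α(k1, x^-1, k2)^-1] at [(k2, x, k1)].  Because a vertical composite may be
    computed with any splitting of [x] ([vcomp_at_split]), and splittings exist
    by essential surjectivity, each groupoid law reduces to the same law in [H]
    for one good choice of splitting:
    - associativity: refine [x] to a threefold product [x1 · x2 · x3];
    - units: split off an identity of [G];
    - inverses: for a splitting [x1 · x2 = ψ z], naturality of [α] along
      the arrow [z] gives the equation between [α] at [x1], [α] at [x2^-1]
      and [u z] that says that the composite is [u z]. *)

Set Implicit Arguments.
Unset Strict Implicit.
Local Open Scope groupoid_scope.

(** * Inverses in a groupoid and preimages under an equivalence *)

Definition inv (G : groupoid) (a b : G) (x : hom a b) : hom b a :=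
  proj1_sig (constructive_indefinite_description _ (is_inv (groupoidP G) x)).

Lemma comp_inv_r (G : groupoid) (a b : G) (x : hom a b) : x · inv x = id a.
Proof.
exact (proj1 (proj2_sig (constructive_indefinite_description _ (is_inv (groupoidP G) x)))).
Qed.

Lemma comp_inv_l (G : groupoid) (a b : G) (x : hom a b) : inv x · x = id b.
Proof.
exact (proj2 (proj2_sig (constructive_indefinite_description _ (is_inv (groupoidP G) x)))).
Qed.

Lemma comp_assoc (G : groupoid) (a b c d : G)
    (x : hom a b) (y : hom b c) (z : hom c d) : x · (y · z) = x · y · z.
Proof. apply (is_assoc (groupoidP G)). Qed.

Lemma comp_id_l (G : groupoid) (a b : G) (x : hom a b) : id a · x = x.
Proof. apply (is_idl (groupoidP G)). Qed.

Lemma comp_id_r (G : groupoid) (a b : G) (x : hom a b) : x · id b = x.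
Proof. apply (is_idr (groupoidP G)). Qed.

Lemma comp_eq_inv (G : groupoid) (a b c d : G)
    (x : hom a b) (y : hom b d) (z : hom a c) (w : hom c d) :
  x · y = z · w -> inv z · x = w · inv y.
Proof.
intros e.
rewrite <- (comp_id_r (inv z · x)), <- (comp_inv_r y), comp_assoc.
now rewrite <- (comp_assoc (inv z)), e, (comp_assoc (inv z)), comp_inv_l, comp_id_l.
Qed.

Section Preimage.
Variables (G H : groupoid) (f : functor G H) (ef : is_equivalence f).

Definition preimage (a b : G) (x : hom (f a) (f b)) : hom a b :=
  proj1_sig (constructive_indefinite_description _ (full_faithful ef a b)) x.

Lemma preimage_fhom (a b : G) (z : hom a b) : preimage (fhom f z) = z.
Proof.
exact (proj1 (proj2_sig (constructive_indefinite_description _ (full_faithful ef a b))) z).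
Qed.

Lemma fhom_preimage (a b : G) (x : hom (f a) (f b)) : fhom f (preimage x) = x.
Proof.
exact (proj2 (proj2_sig (constructive_indefinite_description _ (full_faithful ef a b))) x).
Qed.

End Preimage.

Arguments preimage {G H f} ef {a b} x.

(** * Arrows between morphisms, by components *)

(** The component [α(k1, x, k2)], typed in [H] without reference to the fiber
    product, so that components can be composed and rewritten directly. *)
Definition arrow_at (G H : groupoid) (m1 m2 : mor G H) (al : arrow m1 m2)
    (k1 : mid m1) (k2 : mid m2) (x : hom (mpsi m1 k1) (mpsi m2 k2)) :
  hom (mu m1 k1) (mu m2 k2) := al (Fp k1 k2 x).

Lemma arrow_at_natural (G H : groupoid) (m1 m2 : mor G H) (al : arrow m1 m2)
    (k1 k1' : mid m1) (k2 k2' : mid m2)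
    (x : hom (mpsi m1 k1) (mpsi m2 k2)) (x' : hom (mpsi m1 k1') (mpsi m2 k2'))
    (y : hom k1 k1') (z : hom k2 k2') :
  x · fhom (mpsi m2) z = fhom (mpsi m1) y · x' ->
  fhom (mu m1) y · arrow_at al x' = arrow_at al x · fhom (mu m2) z.
Proof.
intros e.
exact (natural al (FpHom (p := Fp k1 k2 x) (q := Fp k1' k2' x') e)).
Qed.

Lemma arrow_ext (G H : groupoid) (m1 m2 : mor G H) (al be : arrow m1 m2) :
  (forall k1 k2 (x : hom (mpsi m1 k1) (mpsi m2 k2)), arrow_at al x = arrow_at be x) ->
  al = be.
Proof. intros e; apply nattrans_eq; intros [k1 k2 x]; apply e. Qed.

(** The converse of [arrow_at_natural]: natural components assemble into an arrow. *)
Definition mk_arrow (G H : groupoid) (m1 m2 : mor G H)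
    (w : forall k1 k2, hom (mpsi m1 k1) (mpsi m2 k2) -> hom (mu m1 k1) (mu m2 k2))
    (w_natural : forall k1 k1' k2 k2'
      (x : hom (mpsi m1 k1) (mpsi m2 k2)) (x' : hom (mpsi m1 k1') (mpsi m2 k2'))
      (y : hom k1 k1') (z : hom k2 k2'),
      x · fhom (mpsi m2) z = fhom (mpsi m1) y · x' ->
      fhom (mu m1) y · w _ _ x' = w _ _ x · fhom (mu m2) z) :
  arrow m1 m2 :=
  @NatTrans _ _ (mu m1 ∘ fproj1 (mpsi m1) (mpsi m2)) (mu m2 ∘ fproj2 (mpsi m1) (mpsi m2))
    (fun p => w _ _ (fpx p)) (fun p q yz => w_natural _ _ _ _ _ _ _ _ (fph_comm yz)).

Lemma vcomp_at_split (G H : groupoid) (m1 m2 m3 : mor G H)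
    (al1 : arrow m1 m2) (al2 : arrow m2 m3) (k1 : mid m1) (k2 : mid m2) (k3 : mid m3)
    (x : hom (mpsi m1 k1) (mpsi m3 k3))
    (x1 : hom (mpsi m1 k1) (mpsi m2 k2)) (x2 : hom (mpsi m2 k2) (mpsi m3 k3)) :
  x = x1 · x2 -> arrow_at (vcomp al1 al2) x = arrow_at al1 x1 · arrow_at al2 x2.
Proof. exact (@vcompP _ _ _ _ _ al1 al2 k1 k2 k3 x x1 x2). Qed.

(** * Identity arrows, inverse arrows and the groupoid laws *)

Definition id_arrow (G H : groupoid) (m : mor G H) : arrow m m.
Proof.
refine (@mk_arrow G H m m (fun k1 k2 x => fhom (mu m) (preimage (mpsi_equiv m) x)) _).
intros k1 k1' k2 k2' x x' y z e.
rewrite <- !fhom_comp; f_equal.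
(* The two sides have the same image in G, and the functor to G is faithful. *)
rewrite <- (preimage_fhom (mpsi_equiv m) (y · _)), <- (preimage_fhom (mpsi_equiv m) (_ · z)).
now rewrite !fhom_comp, !fhom_preimage, e.
Defined.

Lemma id_arrow_at (G H : groupoid) (m : mor G H) (k k' : mid m) (z : hom k k') :
  arrow_at (id_arrow m) (fhom (mpsi m) z) = fhom (mu m) z.
Proof. unfold arrow_at; simpl; now rewrite preimage_fhom. Qed.

Definition inv_arrow (G H : groupoid) (m1 m2 : mor G H) (al : arrow m1 m2) :
  arrow m2 m1.
Proof.
refine (@mk_arrow G H m2 m1 (fun k2 k1 x => inv (arrow_at al (inv x))) _).
intros k2 k2' k1 k1' x x' y z e.
symmetry; apply comp_eq_inv, arrow_at_natural.
apply comp_eq_inv; symmetry; exact e.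
Defined.

Lemma inv_arrow_at (G H : groupoid) (m1 m2 : mor G H) (al : arrow m1 m2)
    (k1 : mid m1) (k2 : mid m2) (x : hom (mpsi m2 k2) (mpsi m1 k1)) :
  arrow_at (inv_arrow al) x = inv (arrow_at al (inv x)).
Proof. reflexivity. Qed.

Lemma vcomp_assoc (G H : groupoid) (m1 m2 m3 m4 : mor G H)
    (al1 : arrow m1 m2) (al2 : arrow m2 m3) (al3 : arrow m3 m4) :
  vcomp al1 (vcomp al2 al3) = vcomp (vcomp al1 al2) al3.
Proof.
apply arrow_ext; intros k1 k4 x.
destruct (splitting_exists m2 x) as [k2 [x1 [y ex]]].
destruct (splitting_exists m3 y) as [k3 [x2 [x3 ey]]].
rewrite (vcomp_at_split _ _ ex), (vcomp_at_split _ _ ey), comp_assoc.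
rewrite ey, comp_assoc in ex.
now rewrite (vcomp_at_split _ _ ex), (vcomp_at_split al1 al2 eq_refl).
Qed.

Lemma vcomp_id_l (G H : groupoid) (m1 m2 : mor G H) (al : arrow m1 m2) :
  vcomp (id_arrow m1) al = al.
Proof.
apply arrow_ext; intros k1 k2 x.
rewrite (vcomp_at_split _ _ (x1 := fhom (mpsi m1) (id k1)) (x2 := x)).
- now rewrite id_arrow_at, fhom_id, comp_id_l.
- now rewrite fhom_id, comp_id_l.
Qed.

Lemma vcomp_id_r (G H : groupoid) (m1 m2 : mor G H) (al : arrow m1 m2) :
  vcomp al (id_arrow m2) = al.
Proof.
apply arrow_ext; intros k1 k2 x.
rewrite (vcomp_at_split _ _ (x1 := x) (x2 := fhom (mpsi m2) (id k2))).
- now rewrite id_arrow_at, fhom_id, comp_id_r.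
- now rewrite fhom_id, comp_id_r.
Qed.

Lemma vcomp_inv_r (G H : groupoid) (m1 m2 : mor G H) (al : arrow m1 m2) :
  vcomp al (inv_arrow al) = id_arrow m1.
Proof.
apply arrow_ext; intros k k' x.
rewrite <- (fhom_preimage (mpsi_equiv m1) x); set (z := preimage _ x); clearbody z.
destruct (splitting_exists m2 (fhom (mpsi m1) z)) as [k2 [x1 [x2 e]]].
rewrite (vcomp_at_split _ _ e), id_arrow_at, inv_arrow_at.
(* The pair of z and the identity of k2 is an arrow of the fiber product from
   (k, x1, k2) to (k', x2^-1, k2), because x1 · x2 is the image of z. *)
assert (n : fhom (mu m1) z · arrow_at al (inv x2) = arrow_at al x1 · fhom (mu m2) (id k2)).
{ apply arrow_at_natural.
  now rewrite e, fhom_id, <- comp_assoc, comp_inv_r. }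
rewrite fhom_id, comp_id_r in n.
now rewrite <- n, <- comp_assoc, comp_inv_r, comp_id_r.
Qed.

Lemma vcomp_inv_l (G H : groupoid) (m1 m2 : mor G H) (al : arrow m1 m2) :
  vcomp (inv_arrow al) al = id_arrow m2.
Proof.
(* A right inverse which itself has a right inverse is two-sided. *)
rewrite <- (vcomp_inv_r (inv_arrow al)); f_equal.
now rewrite <- (vcomp_id_l (inv_arrow (inv_arrow al))), <- (vcomp_inv_r al),
  <- vcomp_assoc, vcomp_inv_r, vcomp_id_r.
Qed.

Theorem theorem3p7 (G H : groupoid) :
  exists id1 : forall m : mor G H, arrow m m, is_groupoid id1 (@vcomp G H).
Proof.
exists (@id_arrow G H); split.
- exact (@vcomp_assoc G H).
- exact (@vcomp_id_l G H).
- exact (@vcomp_id_r G H).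
- intros m1 m2 al; exists (inv_arrow al).
  split; [ apply vcomp_inv_r | apply vcomp_inv_l ].
Qed.
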